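(* Let $V$ be a real Hilbert space, $A:V\to V'$ the isomorphism induced by a bounded, symmetric, coercive bilinear form $a$ on $V$, $f\in V'$, and let $u\in V$ be the solution of $Au=f$. Let $V_h\subset V$ be a closed subspace and $u_h\in V_h$ the solution of $a(u_h,v)=\langle f,v\rangle$ for all $v\in V_h$. Let $S:V'\to V$ be a symmetric positive-definite operator and let $B:=S+I_hA_h^{-1}Q_h:V'\to V$, which is assumed to be a bounded symmetric positive-definite isomorphism. Suppose that there are constants $\underline{\beta}>0$ and $0<\overline{\beta}<\infty$ such that $$\underline{\beta}\,\langle B^{-1}v,v\rangle\le\langle Av,v\rangle\le\overline{\beta}\,\langle B^{-1}v,v\rangle\qquad\text{for all } v\in V.$$ Then the error $e:=u-u_h\in V$ and the residual $r:=f-Au_h\in V'$ satisfy $$\overline{\beta}^{-1}\langle r,Sr\rangle\le\|e\|_A^2\le\underline{\beta}^{-1}\langle r,Sr\rangle .$$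
   Context: $V'$ is the dual space of $V$ and $\langle\cdot,\cdot\rangle$ is the duality pairing between $V'$ and $V$. The bilinear form $a:V\times V\to\mathbb{R}$ is symmetric and there are constants $\overline{\alpha},\underline{\alpha}>0$ with $a(v,w)\le\overline{\alpha}\|v\|_V\|w\|_V$ and $a(v,v)\ge\underline{\alpha}\|v\|_V^2$ for all $v,w\in V$. The operator $A:V\to V'$ is defined by $\langle Av,w\rangle=a(v,w)$ and $\|v\|_A:=\langle Av,v\rangle^{1/2}$. $I_h:V_h\hookrightarrow V$ is the natural inclusion, $Q_h:=I_h':V'\to V_h'$ is its adjoint, i.e. $\langle Q_hg,v_h\rangle=\langle g,I_hv_h\rangle$ for $g\in V'$, $v_h\in V_h$, and $A_h:=Q_hAI_h:V_h\to V_h'$ (an isomorphism). A linear operator $T:V'\to V$ is called symmetric positive-definite if $(g,g')\mapsto\langle g,Tg'\rangle$ is an inner product on $V'$. *)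

(* Defs.v *)
From HB Require Import structures.
From mathcomp Require Import all_boot all_order all_algebra.
From mathcomp Require Import sesquilinear.
From mathcomp Require Import mathcomp_extra boolp classical_sets functions reals.
From mathcomp Require Import topology normedtype.

Set Implicit Arguments.
Unset Strict Implicit.
Unset Printing Implicit Defensive.

Import Order.TTheory GRing.Theory Num.Theory.
Import numFieldNormedType.Exports.

Local Open Scope classical_set_scope.
Local Open Scope ring_scope.

Section DualSpace.
Context {R : realType} {V : normedModType R}.

Definition continuous_functional : {pred V -> R^o} :=
  fun g => `[< linear g /\ continuous g >].

Lemma continuous_functional_submod_closed :
  submod_closed continuous_functional.
Proof.
split=> [|k g1 g2 /asboolP[lg1 cg1] /asboolP[lg2 cg2]]; apply/asboolP; split.
- by move=> k x y; rewrite [RHS]addr0 scaler0.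
- by move=> x; exact: cvg_cst.
- move=> c x y.
  rewrite -[LHS]/(k *: g1 (c *: x + y) + g2 (c *: x + y)).
  rewrite -[RHS]/(c *: (k *: g1 x + g2 x) + (k *: g1 y + g2 y)).
  by rewrite lg1 lg2 !scalerDr !scalerA [k * c]mulrC addrACA.
- move=> x; apply: cvgD; last exact: cg2.
  by apply: cvgZr; exact: cg1.
Qed.

HB.instance Definition _ := GRing.isSubmodClosed.Build R (V -> R^o)
  continuous_functional continuous_functional_submod_closed.

End DualSpace.

Arguments continuous_functional {R} V.

Record dual (R : realType) (V : normedModType R) := Dual {
  dual_val :> V -> R^o;
  dualP : dual_val \in continuous_functional V }.

HB.instance Definition _ (R : realType) (V : normedModType R) :=
  [isSub for @dual_val R V].
HB.instance Definition _ (R : realType) (V : normedModType R) :=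
  [Choice of dual V by <:].
HB.instance Definition _ (R : realType) (V : normedModType R) :=
  [SubChoice_isSubLmodule of dual V by <:].

Section DualNorm.
Context {R : realType} {V : normedModType R}.
Implicit Types g : dual V.

Definition pairing g (v : V) : R := g v.

Lemma dual_linear g : linear g.
Proof. by have /asboolP[] := dualP g. Qed.

Lemma dual_continuous g : continuous g.
Proof. by have /asboolP[] := dualP g. Qed.

(* The operator norm; it is declared below as the norm of [dual V]. *)
Definition dual_norm g : R := sup [set `|g v| | v in [set v | `|v| <= 1]].

Let dual_lin g : {linear V -> R^o} :=
  HB.pack (dual_val g) (GRing.isLinear.Build _ _ _ _ _ (dual_linear g)).

Lemma dual_bounded g : exists2 M, 0 < M & forall v, `|g v| <= M * `|v|.
Proof.
have /linear_boundedP/pinfty_ex_gt0[M M0 HM] : bounded_near (dual_lin g) (nbhs 0).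
  by apply/linear_bounded_continuous; exact: dual_continuous.
by exists M.
Qed.

Lemma dual0 g : g 0 = 0. Proof. exact: (linear0 (dual_lin g)). Qed.

Lemma dual_scale g k v : g (k *: v) = k * g v.
Proof. exact: (linearZ_LR (dual_lin g)). Qed.

Let ball_ne g : [set `|g v| | v in [set v | `|v| <= 1]] !=set0.
Proof. by exists `|g 0|, 0 => //=; rewrite normr0. Qed.

Let ball_ub g : has_ubound [set `|g v| | v in [set v | `|v| <= 1]].
Proof.
have [M M0 HM] := dual_bounded g.
exists M => _ [v /= v1 <-]; apply: (le_trans (HM v)).
by rewrite ler_piMr // ltW.
Qed.

Let le_dual_norm1 g v : `|v| <= 1 -> `|g v| <= dual_norm g.
Proof. by move=> v1; apply: ub_le_sup => //; exists v. Qed.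

Let dual_norm_le g M :
  (forall v, `|v| <= 1 -> `|g v| <= M) -> dual_norm g <= M.
Proof. by move=> H; apply: ge_sup => // _ [v v1 <-]; exact: H. Qed.

Lemma dual_norm_ge0 g : 0 <= dual_norm g.
Proof. by have := @le_dual_norm1 g 0; rewrite normr0 dual0 normr0; apply. Qed.

Lemma le_dual_norm g v : `|g v| <= dual_norm g * `|v|.
Proof.
have [->|v0] := eqVneq v 0; first by rewrite dual0 !normr0 mulr0.
have nv : 0 < `|v| by rewrite normr_gt0.
rewrite -ler_pdivrMr //; have := @le_dual_norm1 g (`|v|^-1 *: v).
rewrite dual_scale normrM normrZ normfV normr_id mulVf ?gt_eqF//.
by rewrite mulrC; apply.
Qed.

Lemma dual_normD g1 g2 : dual_norm (g1 + g2) <= dual_norm g1 + dual_norm g2.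
Proof.
apply: dual_norm_le => v v1.
rewrite -[(g1 + g2) v]/(g1 v + g2 v); apply: (le_trans (ler_normD _ _)).
by apply: lerD; exact: le_dual_norm1.
Qed.

Lemma dual_normZ k g : dual_norm (k *: g) = `|k| * dual_norm g.
Proof.
have le_c c h : dual_norm (c *: h) <= `|c| * dual_norm h.
  apply: dual_norm_le => v v1; rewrite -[(c *: h) v]/(c * h v) normrM.
  by apply: ler_wpM2l => //; exact: le_dual_norm1.
apply/eqP; rewrite eq_le le_c /=.
have [->|k0] := eqVneq k 0; first by rewrite normr0 mul0r dual_norm_ge0.
have nk : 0 < `|k| by rewrite normr_gt0.
rewrite -ler_pdivlMl // -normfV.
by rewrite -{1}[g]scale1r -(mulVf k0) -scalerA; exact: le_c.
Qed.

Lemma dual_norm0_eq0 g : dual_norm g = 0 -> g = 0.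
Proof.
move=> g0; apply/val_inj/funext => v /=.
apply/eqP; rewrite -normr_le0.
by rewrite (le_trans (le_dual_norm g v)) // g0 mul0r.
Qed.

HB.instance Definition _ := @Lmodule_isNormed.Build R (dual V)
  dual_norm dual_normD dual_normZ dual_norm0_eq0.

End DualNorm.

(* A linear subspace with the restricted norm; closedness is not built in. *)
Definition subspace_of (R : realType) (V : normedModType R)
  (Vh : submodClosed V) := {v : V | v \in Vh}.

Section Subspace.
Context {R : realType} {V : normedModType R} (Vh : submodClosed V).

HB.instance Definition _ := SubType.on (subspace_of Vh).
HB.instance Definition _ := Choice.on (subspace_of Vh).
HB.instance Definition _ := [SubChoice_isSubLmodule of subspace_of Vh by <:].

Definition inclusion (v : subspace_of Vh) : V := \val v.

Definition subspace_norm (v : subspace_of Vh) : R := `|inclusion v|.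

Lemma subspace_normD v w :
  subspace_norm (v + w) <= subspace_norm v + subspace_norm w.
Proof. exact: ler_normD. Qed.

Lemma subspace_normZ k v : subspace_norm (k *: v) = `|k| * subspace_norm v.
Proof. exact: normrZ. Qed.

Lemma subspace_norm0_eq0 v : subspace_norm v = 0 -> v = 0.
Proof. by move=> /normr0_eq0 v0; apply: val_inj. Qed.

HB.instance Definition _ := @Lmodule_isNormed.Build R (subspace_of Vh)
  subspace_norm subspace_normD subspace_normZ subspace_norm0_eq0.

Lemma inclusion_linear : linear inclusion.
Proof. by []. Qed.

Lemma inclusion_continuous : continuous inclusion.
Proof.
move=> v; apply/(@cvgrPdist_lt _ _ _ (nbhs v)) => e e0.
by apply/nbhs_ballP; exists e => //= w; rewrite -ball_normE.
Qed.

Lemma inclusion_adjoint_subproof (g : dual V) :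
  ((g : V -> R^o) \o inclusion) \in continuous_functional (subspace_of Vh).
Proof.
apply/asboolP; split=> [k v w|v] /=; first exact: (dual_linear g).
by apply: continuous_comp; [exact: inclusion_continuous|exact: dual_continuous].
Qed.

Definition inclusion_adjoint (g : dual V) : dual (subspace_of Vh) :=
  Dual (inclusion_adjoint_subproof g).

Lemma inclusion_adjointE (g : dual V) (v : subspace_of Vh) :
  pairing (inclusion_adjoint g) v = pairing g (inclusion v).
Proof. by []. Qed.

End Subspace.

(* A_h = Q_h A I_h, where I_h is [inclusion] and Q_h is [inclusion_adjoint]. *)
Definition galerkin_op (R : realType) (V : normedModType R)
    (Vh : submodClosed V) (A : V -> dual V) :
    subspace_of Vh -> dual (subspace_of Vh) :=
  @inclusion_adjoint R V Vh \o A \o @inclusion R V Vh.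

(* A total function, to be read as f^-1 when f is bijective (see [inverseK]);
   outside the range of f its value is 0. *)
Definition inverse (T : Type) (U : nmodType) (f : U -> T) : T -> U :=
  'pinv_(fun=> 0) setT f.

Lemma inverseK (T : Type) (U : nmodType) (f : U -> T) :
  bijective f -> cancel f (inverse f) /\ cancel (inverse f) f.
Proof.
move=> bf; split=> x.
  by apply: pinvKV; rewrite ?in_setT// => y z _ _; exact: bij_inj.
have [g _ gK] := bf.
by apply: pinvK; apply/mem_set; exists (g x).
Qed.

Definition inner_product (R : realType) (U : lmodType R) (p : U -> U -> R) :=
  exists d : {dot U for idfun}, forall x y, p x y = d x y.

(* [V] is complete by its type; the norm comes from an inner product. *)
Definition hilbert_space (R : realType) (V : completeNormedModType R) :=
  exists d : {dot V for idfun}, forall v, `|v| ^+ 2 = d v v.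

Definition spd (R : realType) (V : normedModType R) (T : dual V -> V) :=
  linear T /\ inner_product (fun g g' : dual V => pairing g (T g')).

(* Between Banach spaces the inverse is then bounded too. *)
Definition bounded_isomorphism (R : realType) (V W : normedModType R)
    (T : V -> W) :=
  [/\ linear T, exists M, forall v, `|T v| <= M * `|v| & bijective T].

Definition energy_norm (R : realType) (V : normedModType R) (A : V -> dual V)
  (v : V) : R := Num.sqrt (pairing (A v) v).

(* Main.v *)
Require Import Defs.
From mathcomp Require Import all_boot all_order all_algebra.
From mathcomp Require Import sesquilinear boolp classical_sets functions reals.
From mathcomp Require Import topology normedtype.
From mathcomp Require Import lra.
Import Order.TTheory GRing.Theory Num.Theory.
Import numFieldNormedType.Exports.
Local Open Scope classical_set_scope.
Local Open Scope ring_scope.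

(** The residual is the error seen through [A]: [r = f - A uh = A e].  Galerkin
    orthogonality says exactly that [r] vanishes on [Vh], so the coarse part of
    [B] does not see it and [B r = S r].  The claim is thus about [B] alone: for
    every [v], the quantity [<A v, B A v>] is comparable to [<A v, v>] with the
    constants of the spectral equivalence.

    That equivalence compares [A] with [B^-1], whereas the claim compares
    [A B A] with [A]; the passage is a Cauchy-Schwarz argument, used once for
    the inner product defined by [B] and once for [a].  Both uses have the same
    shape: one knows [beta * p y y <= p x y] and concludes
    [beta * p x y <= p x x] (lemma [form_le_of_le_form]). *)

(** Cauchy-Schwarz in the form [p x y ^+ 2 <= p x x * p y y], combined with the
    hypothesis and divided by [p x y], would do; expanding
    [0 <= p (x - beta *: y) (x - beta *: y)] gives the same bound without
    separating the case [p x y = 0]. *)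
Lemma form_le_of_le_form (R : realType) (U : lmodType R) (p : {symmetric U})
    (p_ge0 : forall x, 0 <= p x x) (beta : R) (x y : U) :
  0 < beta -> beta * p y y <= p x y -> beta * p x y <= p x x.
Proof.
move=> beta_gt0 le_pxy.
have pC v w : p v w = p w v by rewrite hermC expr0 mul1r.
have : 0 <= p (x - beta *: y) (x - beta *: y) by [].
rewrite linearBl /= !linearBr /= !linearZl_LR /= !linearZr_LR /= (pC y x).
have : beta * (beta * p y y) <= beta * p x y by rewrite ler_wpM2l// ltW.
lra.
Qed.

(** Spectral equivalence of [A] with [B^-1] passes to [A B A] and [A].  Put
    [g := A v].  With [h := B^-1 v], the number [<A v, v>] is the [B]-product of
    [g] and [h]; with [w := B g], the number [<A v, B A v>] is [a v w].  In both
    cases the hypothesis bounds the square of the second factor. *)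
Lemma preconditioner_equivalence (R : realType) (V : normedModType R)
    (a : {symmetric V}) (a_ge0 : forall v, 0 <= a v v)
    (A : V -> dual V) (A_def : forall v w, pairing (A v) w = a v w)
    (B : dual V -> V) (B_spd : spd B) (B_bij : bijective B)
    (beta_lo beta_hi : R) (beta_lo_gt0 : 0 < beta_lo) (beta_hi_gt0 : 0 < beta_hi)
    (spectral : forall v,
      beta_lo * pairing (inverse B v) v <= pairing (A v) v /\
      pairing (A v) v <= beta_hi * pairing (inverse B v) v) (v : V) :
  beta_hi^-1 * pairing (A v) (B (A v)) <= pairing (A v) v /\
  pairing (A v) v <= beta_lo^-1 * pairing (A v) (B (A v)).
Proof.
have [BK BVK] := inverseK B_bij.
have [_ [d dE]] := B_spd.
have d_ge0 g : 0 <= d g g.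
  have [->|g0] := eqVneq g 0; first by rewrite linear0r.
  by apply/ltW/neq0_dnorm_gt0.
split.
  rewrite [pairing (A v) v]A_def A_def.
  apply: form_le_of_le_form => //; first by rewrite invr_gt0.
  rewrite ler_pdivrMl// -!A_def.
  by have [_] := spectral (B (A v)); rewrite BK.
have vE : pairing (A v) v = d (A v) (inverse B v) by rewrite -dE BVK.
have le_vB : beta_lo * d (inverse B v) (inverse B v) <= d (A v) (inverse B v).
  by rewrite -vE -dE BVK; have [] := spectral v.
by rewrite ler_pdivlMl// dE vE; apply: form_le_of_le_form le_vB.
Qed.

(** Definiteness of [a] makes [A_h] injective, and [0] has the preimage [0]; hence the
    value of the partial inverse at [0] is forced. *)
Lemma inverse_galerkin_op0 (R : realType) (V : normedModType R)
    (a : {symmetric V}) (a_definite : forall v, a v v <= 0 -> v = 0)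
    (A : V -> dual V) (A_def : forall v w, pairing (A v) w = a v w)
    (Vh : submodClosed V) :
  inverse (@galerkin_op R V Vh A) 0 = 0.
Proof.
have galE v w : pairing (galerkin_op A v) w = a (inclusion v) (inclusion w).
  by rewrite -A_def.
have gal0 : @galerkin_op R V Vh A 0 = 0.
  by apply/val_inj/funext => w; rewrite -[LHS]/(pairing _ w) galE linear0l.
have galK : galerkin_op A (inverse (@galerkin_op R V Vh A) 0) = 0.
  by apply: pinvK; apply/mem_set; exists 0.
by apply/val_inj/a_definite; rewrite -galE galK.
Qed.

Theorem theorem3p1 (R : realType) (V : completeNormedModType R)
    (V_hilbert : hilbert_space V)
    (a : {symmetric V}) (alpha_lo alpha_hi : R)
    (alpha_lo_gt0 : 0 < alpha_lo) (alpha_hi_gt0 : 0 < alpha_hi)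
    (a_bounded : forall v w : V, a v w <= alpha_hi * `|v| * `|w|)
    (a_coercive : forall v : V, alpha_lo * `|v| ^+ 2 <= a v v)
    (A : V -> dual V) (A_def : forall v w : V, pairing (A v) w = a v w)
    (f : dual V) (u : V) (u_sol : A u = f)
    (Vh : submodClosed V) (Vh_closed : closed [set v : V | v \in Vh])
    (uh : subspace_of Vh)
    (uh_sol : forall v : subspace_of Vh,
      a (inclusion uh) (inclusion v) = pairing f (inclusion v))
    (S : dual V -> V) (S_spd : spd S) :
  let B : dual V -> V := fun g =>
    S g + inclusion (inverse (galerkin_op A) (inclusion_adjoint Vh g)) in
  forall (B_iso : bounded_isomorphism B) (B_spd : spd B)
    (beta_lo beta_hi : R) (beta_lo_gt0 : 0 < beta_lo) (beta_hi_gt0 : 0 < beta_hi)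
    (spectral : forall v : V,
      beta_lo * pairing (inverse B v) v <= pairing (A v) v /\
      pairing (A v) v <= beta_hi * pairing (inverse B v) v),
  let e : V := u - inclusion uh in
  let r : dual V := f - A (inclusion uh) in
  beta_hi^-1 * pairing r (S r) <= energy_norm A e ^+ 2 /\
  energy_norm A e ^+ 2 <= beta_lo^-1 * pairing r (S r).
Proof.
move=> B B_iso B_spd beta_lo beta_hi beta_lo_gt0 beta_hi_gt0 spectral e r.
have a_ge0 v : 0 <= a v v.
  by apply: le_trans (a_coercive v); rewrite mulr_ge0 ?sqr_ge0 ?ltW.
have a_definite v : a v v <= 0 -> v = 0.
  move=> /(le_trans (a_coercive v)).
  by rewrite pmulr_rle0// real_exprn_even_le0//= normr_eq0 => /eqP.
have rE : r = A e.
  apply/val_inj/funext => w; rewrite -[RHS]/(pairing (A e) w) A_def linearBl /=.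
  by rewrite -!A_def u_sol.
have Qr0 : inclusion_adjoint Vh r = 0.
  apply/val_inj/funext => v.
  rewrite -[LHS]/(pairing f (inclusion v) - pairing (A (inclusion uh)) (inclusion v)).
  by rewrite A_def uh_sol subrr.
have BrE : B r = S r.
  by rewrite /B Qr0 (inverse_galerkin_op0 _ _ _ a_definite _ A_def) addr0.
have [_ _ B_bij] := B_iso.
rewrite /energy_norm sqr_sqrtr ?A_def// -A_def -BrE rE.
exact: preconditioner_equivalence.
Qed.
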